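(* Let $G=(V,E)$ be a finite loopless multigraph whose edges operate independently with probabilities $p(e)\in[0,1]$, let $K\subseteq V$ with $|K|\ge2$, and let $(G^1,G^2,X)$ be a $K$-splitting of $(G,K)$. Then \[ R(G,K)=\mathbf{p}(G^1)^T\,\mathbf{M}\,\mathbf{p}(G^2). \]
   Context: Labelled set partitions: for a finite set $Y$ and a symbol $l\notin Y$, a labelled set partition of $Y$ is $\pi=\{B_1\cup L_1,\dots,B_k\cup L_k\}$ with $\{B_1,\dots,B_k\}$ a set partition of $Y$ and $L_i\in\{\emptyset,\{l\}\}$ (labelled block iff $L_i=\{l\}$). $\Pi_l(Y)$ is the set of these, ordered by $\sigma\le\pi$ iff every block of $\sigma$ (including $l$ if present) is contained in a block of $\pi$; it is a lattice with join $\vee$. $m(\pi)=1$ if $\pi$ has exactly one labelled block, else $0$. For $\pi\in\Pi_l(W)$ and $Y\subseteq W$, $\pi\sqcap Y\in\Pi_l(Y)$ has blocks $(B\cap Y)\cup L$ for the blocks $B\cup L$ of $\pi$ with $B\cap Y\ne\emptyset$. Graphs may have parallel edges but no loops. A spanning subgraph of a graph $H=(W,F)$ is $(W,F')$, $F'\subseteq F$, with probability $\mathrm{Pr}(H')=\prod_{e\in F'}p(e)\prod_{e\in F\setminus F'}(1-p(e))$. For $K'\subseteq W$: $M(H,K')=1$ if all of $K'$ lies in one connected component, else $0$; $R(H,K')=\sum_{H'}M(H',K')\mathrm{Pr}(H')$ over spanning subgraphs $H'$ of $H$; $\{(H,K')\}\in\Pi_l(W)$ has as blocks the vertex sets of connected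 components of $H$, labelled iff meeting $K'$. For $Y\subseteq W$, $H_Y$ identifies all of $Y$ into one vertex $Y$, deleting edges with both endpoints in $Y$ and keeping other edges. $K$-splitting: $G^i=(V^i,E^i)$ subgraphs of $G$ with $E^1\cup E^2=E$, $E^1\cap E^2=\emptyset$, $V^1\cup V^2=V$, $V^1\cap V^2=X$, $K^i:=K\cap V^i\ne\emptyset$. $K^i_X=(K^i\setminus X)\cup\{X\}$. For a spanning subgraph $H^i$ of $G^i$, $D(H^i,\pi)=1$ if $\{(H^i,K^i)\}\sqcap X=\pi$, else $0$. Partition probability: $P(G^i,\pi)=\sum_{H^i}D(H^i,\pi)M(H^i_X,K^i_X)\mathrm{Pr}(H^i)$ over spanning subgraphs $H^i$ of $G^i$. $\pi_X\in\Pi_l(X)$ is the partition into singletons $\{x\}$, labelled iff $x\in K$; $\Pi_l(X,\pi_X)=\{\pi\in\Pi_l(X):\pi\ge\pi_X,\ \pi\text{ has a labelled block}\}$. With a fixed ordering of $\Pi_l(X,\pi_X)$: $\mathbf{p}(G^i)=(P(G^i,\pi))_{\pi}$ and $\mathbf{M}=(m(\pi\vee\sigma))_{\pi,\sigma\in\Pi_l(X,\pi_X)}$. *)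

(* Defs.v *)
From HB Require Import structures.
From mathcomp Require Import all_boot all_order all_algebra.

Set Implicit Arguments.
Unset Strict Implicit.
Unset Printing Implicit Defensive.

Import Order.TTheory GRing.Theory Num.Theory.
Local Open Scope ring_scope.

(* In [option T], [None] plays the role of the extra symbol l, so that the
   labelled block B U {l} is [None |: Some @: B] and the unlabelled block B is
   [Some @: B]. *)

Section LabelledPartitions.
Variable T : finType.
Implicit Types (A B : {set option T}) (Y : {set T}).
Implicit Types (s t : {set {set option T}}).

Definition base A : {set T} := Some @^-1: A.

Definition lblock (B : {set T}) (b : bool) : {set option T} :=
  if b then None |: Some @: B else Some @: B.

(* The injectivity of [base] on [s] excludes that B and B U {l} both occur. *)
Definition is_lpart Y s : bool :=
  partition [set base A | A in s] Y && dinjectiveb base (mem s).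

Definition lpart_le s t : bool :=
  [forall A in s, [exists B in t, A \subset B]].

Definition labelled_blocks s : {set {set option T}} :=
  [set A in s | None \in A].

Definition mlab s : bool := #|labelled_blocks s| == 1%N.

Definition lrestrict s Y : {set {set option T}} :=
  [set A :&: (None |: Some @: Y) | A in s & base A :&: Y != set0].

Definition lsingletons (K X : {set T}) : {set {set option T}} :=
  [set lblock [set x] (x \in K) | x in X].

Lemma in_base A x : (x \in base A) = (Some x \in A).
Proof. by rewrite inE. Qed.

Lemma base_lblock (B : {set T}) b : base (lblock B b) = B.
Proof.
apply/setP=> x; rewrite in_base /lblock; case: b; rewrite ?inE /=;
  by rewrite mem_imset //; apply: Some_inj.
Qed.

Lemma is_lpartP Y s :
  reflect [/\ forall A, A \in s -> base A != set0 /\ base A \subset Y,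
              forall y, y \in Y -> exists2 A, A \in s & Some y \in A
            & forall A B y, A \in s -> B \in s ->
                Some y \in A -> Some y \in B -> A = B]
          (is_lpart Y s).
Proof.
apply: (iffP andP) => [[/and3P[/eqP covY /trivIsetP triv n0] /dinjectiveP inj]|].
  split=> [A As|y yY|A B y As Bs yA yB].
  - split; first by apply: contraNneq n0 => <-; apply: imset_f.
    by rewrite -covY; apply: (bigcup_max (base A)) => //; apply: imset_f.
  - move: yY; rewrite -covY => /bigcupP[_ /imsetP[A As ->]].
    by rewrite in_base; exists A.
  - apply: inj => //; apply/eqP/negPn/negP => neq.
    have := triv _ _ (imset_f base As) (imset_f base Bs) neq.
    by move/disjointFr => /(_ y); rewrite !in_base yA yB => /(_ isT).
case=> h1 h2 h3; split; last first.
  apply/dinjectiveP => A B As Bs eqAB.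
  have [/set0Pn[y yA] _] := h1 _ As.
  by apply: (h3 A B y) => //; rewrite -in_base -?eqAB.
apply/and3P; split.
- apply/eqP/setP=> y; apply/bigcupP/idP => [[_ /imsetP[A As ->]]|yY].
    by have [_ /subsetP] := h1 _ As; apply.
  have [A As yA] := h2 _ yY.
  by exists (base A); [apply: imset_f | rewrite in_base].
- apply/trivIsetP => _ _ /imsetP[A As ->] /imsetP[B Bs ->] neq.
  rewrite -setI_eq0; apply: contraNT neq => /set0Pn[y].
  by rewrite inE !in_base => /andP[yA yB]; rewrite (h3 A B y).
- by apply/imsetP=> -[A As e]; have [/eqP] := h1 _ As; rewrite -e.
Qed.

Record lpart Y := LPart { lpval :> {set {set option T}}; _ : is_lpart Y lpval }.

HB.instance Definition _ Y := [isSub for @lpval Y].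
HB.instance Definition _ Y := [Finite of lpart Y by <:].

Lemma lsingletons_subproof (K X : {set T}) : is_lpart X (lsingletons K X).
Proof.
apply/is_lpartP; split=> [A /imsetP[x xX ->]|y yX|].
- rewrite base_lblock sub1set; split=> //.
  by apply/set0Pn; exists x; rewrite inE.
- exists (lblock [set y] (y \in K)); first by apply: imset_f.
  by rewrite -in_base base_lblock inE.
- move=> A B y /imsetP[x _ ->] /imsetP[z _ ->].
  by rewrite -!in_base !base_lblock !inE => /eqP <- /eqP <-.
Qed.

Definition pi_X (K X : {set T}) : lpart X := LPart (lsingletons_subproof K X).

End LabelledPartitions.

Fact lpart_display : Order.disp_t. Proof. exact: Order.Disp tt tt. Qed.

Section LabelledPartitionLattice.
Variables (T : finType) (Y : {set T}).
Implicit Types s t u : lpart Y.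

Lemma lpart_leP (s t : {set {set option T}}) :
  reflect (forall A, A \in s -> exists2 B, B \in t & A \subset B)
          (lpart_le s t).
Proof.
apply: (iffP forall_inP) => h A /h.
  by move/exists_inP.
by move=> ?; apply/exists_inP.
Qed.

Let le s t := lpart_le s t.

Fact lpart_le_refl : reflexive le.
Proof. by move=> s; apply/lpart_leP => A As; exists A. Qed.

Fact lpart_le_trans : transitive le.
Proof.
move=> t s u /lpart_leP st /lpart_leP tu; apply/lpart_leP => A /st[B /tu[C uC BC]].
by move=> AB; exists C => //; apply: subset_trans BC.
Qed.

Fact lpart_le_sub s t : le s t -> le t s -> lpval s \subset t.
Proof.
case: s => s ps /=; rewrite /le /= => /lpart_leP st /lpart_leP ts.
have [h1 _ h3] := is_lpartP _ _ ps; apply/subsetP => A As.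
have [B Bt AB] := st _ As; have [C Cs BC] := ts _ Bt.
have [/set0Pn[y]] := h1 _ As; rewrite in_base => yA _.
have eAC : A = C.
  by apply: (h3 A C y) => //; apply: (subsetP BC); apply: (subsetP AB).
by rewrite (_ : A = B) //; apply/eqP; rewrite eqEsubset AB eAC.
Qed.

Fact lpart_le_anti : antisymmetric le.
Proof.
move=> s t /andP[st ts]; apply/val_inj/eqP.
by rewrite eqEsubset !lpart_le_sub.
Qed.

HB.instance Definition _ :=
  Order.Le_isPOrder.Build lpart_display (lpart Y) lpart_le_refl lpart_le_anti lpart_le_trans.

Definition lmeet (s t : {set {set option T}}) : {set {set option T}} :=
  [set A in [set B :&: C | B in s, C in t] | base A != set0].

Fact lmeet_subproof s t : is_lpart Y (lmeet s t).
Proof.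
case: s t => [s /= /is_lpartP[s1 s2 s3]] [t /= /is_lpartP[t1 t2 t3]].
apply/is_lpartP; split=> [A|y yY|A B y].
- rewrite inE => /andP[/imset2P[B C Bs Ct ->] n0]; split=> //.
  by have [_ BY] := s1 _ Bs; rewrite /base preimsetI subIset // BY.
- have [B Bs yB] := s2 _ yY; have [C Ct yC] := t2 _ yY.
  exists (B :&: C); last by rewrite inE yB.
  rewrite inE imset2_f //=; apply/set0Pn; exists y.
  by rewrite in_base inE yB.
- rewrite !inE => /andP[/imset2P[B1 C1 ? ? ->] _].
  move=> /andP[/imset2P[B2 C2 ? ? ->] _].
  rewrite !inE => /andP[? ?] /andP[? ?].
  by rewrite (s3 B1 B2 y) // (t3 C1 C2 y).
Qed.

Let meet s t : lpart Y := LPart (lmeet_subproof s t).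

Fact lpart_le_meet u s t : (u <= meet s t)%O = (u <= s)%O && (u <= t)%O.
Proof.
apply/lpart_leP/andP => [h|[/lpart_leP hs /lpart_leP ht] A Au].
  split; apply/lpart_leP => A /h[B]; rewrite inE => /andP[/imset2P[C D ? ? ->] _];
    rewrite subsetI => /andP[? ?]; by [exists C|exists D].
have [B Bs AB] := hs _ Au; have [C Ct AC] := ht _ Au.
exists (B :&: C); last by rewrite subsetI AB.
rewrite inE imset2_f //=.
case: u Au {hs ht} => u /= /is_lpartP[u1 _ _] Au.
have [/set0Pn[y yA] _] := u1 _ Au; apply/set0Pn; exists y.
by move: yA; rewrite !in_base inE => yA; rewrite (subsetP AB) ?(subsetP AC).
Qed.

HB.instance Definition _ :=
  Order.POrder_isMeetSemilattice.Build lpart_display (lpart Y) lpart_le_meet.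

Fact ltop_subproof :
  is_lpart Y (if Y == set0 then set0 else [set lblock Y true]).
Proof.
apply/is_lpartP; case: eqVneq => [->|Yn0]; split.
- by move=> A; rewrite inE.
- by move=> y; rewrite inE.
- by move=> A B y; rewrite inE.
- by move=> A; rewrite inE => /eqP->; rewrite base_lblock.
- move=> y yY; exists (lblock Y true); first by rewrite inE.
  by rewrite -in_base base_lblock.
- by move=> A B y; rewrite !inE => /eqP-> /eqP->.
Qed.

Let top : lpart Y := LPart ltop_subproof.

Fact lpart_le_top s : (s <= top)%O.
Proof.
case: s => s ps; have [s1 _ _] := is_lpartP _ _ ps.
apply/lpart_leP => A /= As; have [n0 AY] := s1 _ As.
have Yn0 : Y != set0 by apply: contraNneq n0 => Y0; rewrite -subset0 -{1}Y0.
exists (lblock Y true); first by rewrite (negPf Yn0) inE.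
apply/subsetP => -[y yA|]; last by rewrite !inE.
by rewrite -in_base base_lblock (subsetP AY) // in_base.
Qed.

HB.instance Definition _ :=
  Order.hasTop.Build lpart_display (lpart Y) lpart_le_top.

(* The join is the least upper bound, obtained as the meet of all upper bounds. *)
Let join s t : lpart Y :=
  (\meet_(u : lpart Y | (s <= u)%O && (t <= u)%O) u)%O.

Fact lpart_join_le s t u : (join s t <= u)%O = (s <= u)%O && (t <= u)%O.
Proof.
apply/idP/idP => [h|su].
  by apply/andP; split; apply: le_trans h;
     apply/meetsP => v /andP[].
exact: (@meets_inf _ _ _ _ (fun u : lpart Y => (s <= u)%O && (t <= u)%O) id).
Qed.

HB.instance Definition _ :=
  Order.POrder_isJoinSemilattice.Build lpart_display (lpart Y) lpart_join_le.

End LabelledPartitionLattice.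

Definition Pi_l_X (T : finType) (K X : {set T}) : {set lpart X} :=
  [set s : lpart X | (pi_X K X <= s)%O & labelled_blocks s != set0].

(* A finite loopless multigraph whose vertices lie in [T] and whose edges are
   named by elements of [U]; two-element [ends] exclude loops, and different
   edges may have the same [ends].  The values of [ends] outside [eset] are
   irrelevant. *)
Record mgraph (T U : finType) := MGraph {
  vset : {set T};
  eset : {set U};
  ends : U -> {set T};
  ends_wf : [forall e in eset, (ends e \subset vset) && (#|ends e| == 2)]
}.

Section Graphs.
Variables (T U : finType).
Implicit Types (H : mgraph T U) (F : {set U}) (Y K : {set T}).

Definition subgraph H1 H : Prop :=
  [/\ vset H1 \subset vset H, eset H1 \subset eset H
    & {in eset H1, ends H1 =1 ends H}].

Fact spanning_subproof H F :
  [forall e in eset H :&: F, (ends H e \subset vset H) && (#|ends H e| == 2)].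
Proof.
by apply/forall_inP=> e /setIP[eH _]; exact: (forall_inP (ends_wf H)).
Qed.

Definition spanning H F : mgraph T U := MGraph (spanning_subproof H F).

(* H_Y lives on [option T]; here [None] is the new vertex Y. *)
Definition merge Y (x : T) : option T := if x \in Y then None else Some x.

Fact identify_subproof H Y :
  [forall e in [set e in eset H | ~~ (ends H e \subset Y)],
     (merge Y @: ends H e \subset None |: Some @: (vset H :\: Y))
     && (#|merge Y @: ends H e| == 2)].
Proof.
apply/forall_inP=> e; rewrite inE => /andP[eH nY].
have /andP[eV /cards2P[a [b [ab eab]]]] := forall_inP (ends_wf H) _ eH.
apply/andP; split.
  apply/subsetP => _ /imsetP[x xe ->]; rewrite /merge.
  case: ifP => [_|xY]; first by rewrite !inE.
  by rewrite inE imset_f ?orbT // inE xY (subsetP eV).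
apply/cards2P; exists (merge Y a), (merge Y b); split; last first.
  by rewrite eab imsetU1 imset_set1.
move: nY; rewrite eab subUset !sub1set /merge.
by case: (a \in Y); case: (b \in Y) => //= _; apply: contra_neq ab => -[].
Qed.

Definition identify H Y : mgraph (option T) U := MGraph (identify_subproof H Y).

Definition adj H : rel T :=
  [rel x y | [exists e in eset H, ends H e == [set x; y]]].

Definition components H : {set {set T}} :=
  [set [set y in vset H | connect (adj H) x y] | x in vset H].

Definition Mconn H K : bool := [exists C in components H, K \subset C].

Definition graph_lpart H K : {set {set option T}} :=
  [set lblock C (C :&: K != set0) | C in components H].

End Graphs.

(* K^i_X, a vertex set of [identify H^i X]. *)
Definition identify_set (T : finType) (K X : {set T}) : {set option T} :=
  None |: Some @: (K :\: X).

(* The identity is algebraic, so probabilities may lie in any realFieldType. *)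
Section Reliability.
Variables (R : realFieldType) (T U : finType) (p : U -> R).
Implicit Types (H : mgraph T U) (K X : {set T}).

Definition Pr H (F : {set U}) : R :=
  \prod_(e in F) p e * \prod_(e in eset H :\: F) (1 - p e).

Definition reliability H K : R :=
  \sum_(F : {set U} | F \subset eset H) (Mconn (spanning H F) K)%:R * Pr H F.

Definition Dind H K X (s : lpart X) : bool :=
  lrestrict (graph_lpart H K) X == s.

Definition partition_prob H K X (s : lpart X) : R :=
  \sum_(F : {set U} | F \subset eset H)
    (Dind (spanning H F) K s)%:R
    * (Mconn (identify (spanning H F) X) (identify_set K X))%:R
    * Pr H F.

Definition pvec H K X n (o : n.-tuple (lpart X)) : 'cV[R]_n :=
  \col_i partition_prob H K (tnth o i).

Definition joinmx (X : {set T}) n (o : n.-tuple (lpart X)) : 'M[R]_n :=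
  \matrix_(i, j) (mlab (tnth o i `|` tnth o j)%O)%:R.

End Reliability.

Record K_splitting (T U : finType) (G : mgraph T U) (K : {set T})
    (G1 G2 : mgraph T U) (X : {set T}) : Prop := KSplitting {
  split_sub1 : subgraph G1 G;
  split_sub2 : subgraph G2 G;
  split_edges : eset G1 :|: eset G2 = eset G;
  split_edges_disjoint : eset G1 :&: eset G2 = set0;
  split_vertices : vset G1 :|: vset G2 = vset G;
  split_separator : vset G1 :&: vset G2 = X;
  split_K1 : K :&: vset G1 != set0;
  split_K2 : K :&: vset G2 != set0
}.

(* Main.v *)
(* Conditioning on the state F = F1 U F2 of the edges, Pr factors over the two
   sides, so it suffices to evaluate the summand for fixed subgraphs H1, H2 and
   their union H.  M(H^i_X, K^i_X) = 1 says that every vertex of K^i reaches X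
   inside H^i.  The join of the partitions induced on X by H1 and H2 is the one
   induced by H, because a path of H changes sides only at vertices of X.  When
   every vertex of K reaches X, the labelled blocks of that join correspond to
   the components of H meeting K, so exactly one of them means that H connects
   K; and if H connects K, then a path from K^1 to K^2 must cross X. *)
Require Import Defs.
From mathcomp Require Import all_boot all_order all_algebra.
Import Order.TTheory GRing.Theory Num.Theory.
Local Open Scope ring_scope.

Set Implicit Arguments.
Unset Strict Implicit.
Unset Printing Implicit Defensive.

(** * Induction along paths, and sums over the subsets of a disjoint union *)

Lemma connect_ind (T : finType) (e : rel T) (P : T -> Prop) (x y : T) :
  (forall u v, e u v -> P u -> P v) -> connect e x y -> P x -> P y.
Proof.
move=> Pe /connectP[s]; elim: s x => [|z s IHs] x /= => [_ -> //|].
by move=> /andP[xz zs] ey Px; apply: (IHs z) => //; apply: Pe xz Px.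
Qed.

(** A subset of the union corresponds to the pair of its traces on [A] and [B]; disjointness makes
    [F1 :|: F2] invert this. *)
Lemma big_subsetU (R : Type) (idx : R) (op : Monoid.com_law idx)
    (U : finType) (A B : {set U}) (f : {set U} -> R) :
  A :&: B = set0 ->
  \big[op/idx]_(F : {set U} | F \subset A :|: B) f F =
  \big[op/idx]_(F1 : {set U} | F1 \subset A)
    \big[op/idx]_(F2 : {set U} | F2 \subset B) f (F1 :|: F2).
Proof.
move=> AB0; rewrite pair_big_dep /=.
rewrite (reindex_onto (fun F12 : {set U} * {set U} => F12.1 :|: F12.2)
                      (fun F => (F :&: A, F :&: B))) /=; last first.
  by move=> F FAB; rewrite -setIUr; apply/setIidPl.
apply: eq_bigl => -[F1 F2] /=; apply/andP/andP => [[_ /eqP[<- <-]]|[F1A F2B]].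
  by rewrite !subsetIr.
split; first exact: setUSS.
have F12 : F2 :&: A = set0.
  by apply/eqP; rewrite -subset0 -AB0 setIC setIS.
have F21 : F1 :&: B = set0 by apply/eqP; rewrite -subset0 -AB0 setSI.
by rewrite !setIUl F12 F21 setU0 set0U (setIidPl F1A) (setIidPl F2B).
Qed.

(** * Components and the labelled partition they induce on a vertex set *)

Section Connectivity.
Variables (T U : finType).
Implicit Types (H : mgraph T U) (K X : {set T}).

Definition component H x : {set T} := [set y in vset H | connect (adj H) x y].

Lemma adj_sym H : symmetric (adj H).
Proof. by move=> x y; rewrite /adj /= setUC. Qed.

Lemma connect_adj_sym H : connect_sym (adj H).
Proof. exact: sym_connect_sym (@adj_sym H). Qed.

Lemma adjP H x y :
  reflect (exists2 e, e \in eset H & ends H e = [set x; y]) (adj H x y).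
Proof. by apply: (iffP exists_inP) => -[e eH /eqP ee]; exists e. Qed.

Lemma adj_vset H x y : adj H x y -> x \in vset H /\ y \in vset H.
Proof.
case/adjP=> e eH ee; have /andP[/subsetP sV _] := forall_inP (ends_wf H) _ eH.
by split; apply: sV; rewrite ee !inE eqxx ?orbT.
Qed.

Lemma connect_vset H x y : connect (adj H) x y -> x \in vset H -> y \in vset H.
Proof.
by apply: (connect_ind (P := fun v => v \in vset H)) => u v /adj_vset[].
Qed.

Lemma eq_component H x y : connect (adj H) x y -> component H x = component H y.
Proof.
move=> xy; apply/setP=> z.
by rewrite !inE (same_connect (@connect_adj_sym H) xy).
Qed.

Lemma MconnP H K :
  reflect (exists2 x, x \in vset H & K \subset component H x) (Mconn H K).
Proof.
apply: (iffP exists_inP) => [[_ /imsetP[x xH ->] KC]|[x xH KC]]; first by exists x.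
by exists (component H x) => //; apply/imsetP; exists x.
Qed.

Lemma Some_lblock (C : {set T}) b y : (Some y \in lblock C b) = (y \in C).
Proof. by rewrite -in_base base_lblock. Qed.

Lemma None_lblock (C : {set T}) b : (None \in lblock C b) = b.
Proof.
case: b; rewrite /lblock; first by rewrite setU11.
by apply/negP => /imsetP[].
Qed.

(** A component meeting [X] is the component of any of its points in [X], so blocks can be indexed
    by points of [X]. The label comes from the whole component, which may meet [K] only outside
    [X]. *)
Lemma lrestrict_graphP H K X A : X \subset vset H ->
  reflect (exists2 x, x \in X &
             A = lblock (component H x :&: X) (component H x :&: K != set0))
          (A \in lrestrict (graph_lpart H K) X).
Proof.
move=> /subsetP XV.
have lblockI (C : {set T}) b : lblock C b :&: (None |: Some @: X) = lblock (C :&: X) b.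
  rewrite -[None |: _]/(lblock X true); apply/setP=> -[y|]; rewrite in_setI.
    by rewrite !Some_lblock inE.
  by rewrite !None_lblock andbT.
apply: (iffP imsetP) => [[B]|[x xX ->]].
  rewrite inE => /andP[/imsetP[_ /imsetP[z zH ->] ->]].
  rewrite base_lblock => /set0Pn[x] /setIP[xC xX] ->; exists x => //.
  rewrite lblockI -/(component H z) (@eq_component H z x) //.
  by move: xC; rewrite inE => /andP[].
exists (lblock (component H x) (component H x :&: K != set0)); last by rewrite lblockI.
rewrite inE base_lblock; apply/andP; split.
  by apply: imset_f; apply/imsetP; exists x; rewrite ?XV.
by apply/set0Pn; exists x; rewrite !inE xX XV ?connect0.
Qed.

Lemma lrestrict_graph_lpart H K X : X \subset vset H ->
  is_lpart X (lrestrict (graph_lpart H K) X).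
Proof.
move=> XV; have /subsetP XVi := XV; apply/is_lpartP; split.
- move=> _ /(lrestrict_graphP _ _ XV)[x xX ->]; rewrite base_lblock subsetIr; split=> //.
  by apply/set0Pn; exists x; rewrite !inE connect0 xX XVi.
- move=> y yX; exists (lblock (component H y :&: X) (component H y :&: K != set0)).
    by apply/lrestrict_graphP => //; exists y.
  by rewrite Some_lblock !inE connect0 yX XVi.
- move=> _ _ y /(lrestrict_graphP _ _ XV)[x xX ->] /(lrestrict_graphP _ _ XV)[z zX ->].
  rewrite !Some_lblock !inE => /andP[/andP[_ xy] _] /andP[/andP[_ zy] _].
  by rewrite (eq_component xy) (eq_component zy).
Qed.

Definition graph_lpart_on H K X (XV : X \subset vset H) : lpart X :=
  LPart (lrestrict_graph_lpart K XV).

(** Upper bounds are expressed by connectivity alone, so the join can be handled through its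
    universal property, without describing its blocks. *)
Lemma graph_lpart_onP H K X (XV : X \subset vset H) (u : lpart X) :
  reflect (forall x, x \in X -> exists B, [/\ B \in lpval u, Some x \in B,
            forall y, y \in X -> connect (adj H) x y -> Some y \in B &
            forall k, k \in K -> k \in vset H -> connect (adj H) x k -> None \in B])
          (graph_lpart_on K XV <= u)%O.
Proof.
have /subsetP XVi := XV; apply: (iffP (lpart_leP _ _)) => h.
  move=> x xX; case: (h (lblock (component H x :&: X) (component H x :&: K != set0))).
    by apply/lrestrict_graphP => //; exists x.
  move=> B Bu /subsetP sB; exists B; split=> //.
  - by apply: sB; rewrite Some_lblock !inE connect0 xX XVi.
  - by move=> y yX xy; apply: sB; rewrite Some_lblock !inE xy yX XVi.
  - move=> k kK kV xk; apply: sB; rewrite None_lblock; apply/set0Pn.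
    by exists k; rewrite !inE kV xk.
move=> _ /(lrestrict_graphP _ _ XV)[x xX ->]; have [B [Bu _ h1 h2]] := h _ xX.
exists B => //; apply/subsetP => -[y|].
  by rewrite Some_lblock !inE => /andP[/andP[_ xy] yX]; apply: h1.
rewrite None_lblock => /set0Pn[k]; rewrite !inE => /andP[/andP[kV xk] kK].
exact: h2 kK kV xk.
Qed.

End Connectivity.

(** * Terminals that reach the separator *)

Section Reaching.
Variables (T U : finType).
Implicit Types (H : mgraph T U) (K X : {set T}).

Definition reaches H K X : bool :=
  [forall k in K, [exists x in X, connect (adj H) k x]].

(** Since [None] belongs to [identify_set K X], connectedness means that each terminal reaches the
    merged vertex. Up to its first visit to [None], a path in the identified graph lifts to [H];
    conversely paths of [H] project along [merge X]. *)
Lemma Mconn_identify H K X : K \subset vset H ->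
  Mconn (identify H X) (identify_set K X) = reaches H K X.
Proof.
move=> /subsetP KV; have idsym := @connect_adj_sym _ _ (identify H X).
apply/MconnP/forall_inP => [[z zV /subsetP sub] k kK|h].
  have [kX|kX] := boolP (k \in X); first by apply/exists_inP; exists k.
  have Nk : connect (adj (identify H X)) (Some k) None.
    have /sub : None \in identify_set K X by apply: setU11.
    have /sub : Some k \in identify_set K X.
      by apply: setU1r; rewrite imset_f // inE kX.
    rewrite inE => /andP[_ zk]; rewrite inE => /andP[_ zN].
    by rewrite idsym in zk; apply: connect_trans zk zN.
  case: exists_inP => // noX; exfalso.
  (* If [k] reaches no vertex of [X], the set of [Some v] with [v] connected to [k] is closed under
     adjacency, so it would have to contain [None]. *)
  suff : if None is Some v then connect (adj H) k v else False by [].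
  apply: (connect_ind (P := fun w => if w is Some v then is_true (connect (adj H) k v)
    else False)) Nk _; last exact: connect0.
  move=> [v|//] w /adjP[e]; rewrite inE => /andP[eH eX] /= ee kv.
  have /andP[_ /cards2P[a [b [_ eab]]]] := forall_inP (ends_wf H) _ eH.
  have closed a' b' : ends H e = [set a'; b'] -> Defs.merge X a' = Some v ->
      Defs.merge X b' = Some b' /\ connect (adj H) k b'.
    move=> e'; rewrite /Defs.merge; case: ifP => // _ [av]; rewrite av in e'.
    have kb : connect (adj H) k b'.
      by apply: connect_trans kv (connect1 _); apply/adjP; exists e.
    by split=> //; case: ifP => // b'X; case: noX; exists b'.
  have eba : ends H e = [set b; a] by rewrite eab setUC.
  have im : [set Defs.merge X a; Defs.merge X b] = [set Some v; w].
    by rewrite -ee eab imsetU1 imset_set1.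
  have := set22 (Some v) w; have := set21 (Some v) w; rewrite -im !inE.
  case/orP=> /eqP ev; case/orP=> /eqP ->.
  - by rewrite -ev.
  - by have [-> ] := closed _ _ eab (esym ev).
  - by have [-> ] := closed _ _ eba (esym ev).
  - by rewrite -ev.
exists None; first by rewrite !inE.
apply/subsetP => w /setU1P[->|/imsetP[k /setDP[kK kX] ->]]; rewrite inE.
  by rewrite setU11 connect0.
apply/andP; split; first by apply: setU1r; rewrite imset_f // inE kX KV.
rewrite idsym.
have /exists_inP[x xX kx] := h _ kK.
have -> : None = Defs.merge X x by rewrite /Defs.merge xX.
apply: (connect_ind (P := fun v => connect (adj (identify H X)) (Some k) (Defs.merge X v)))
  kx _; last by rewrite /Defs.merge (negPf kX) connect0.
move=> u v /adjP[e eH ee] ku; apply: connect_trans ku _.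
(* An edge inside [X] is deleted by the identification, but both its ends are sent to [None]. *)
have [eX|eX] := boolP (ends H e \subset X).
  move: eX; rewrite ee subUset !sub1set /Defs.merge => /andP[-> ->]; exact: connect0.
apply: connect1; apply/adjP; exists e; first by rewrite inE eH.
by rewrite /= ee imsetU1 imset_set1.
Qed.

(** By [reaches], every component meeting [K] also meets [X], so none is lost in the restriction,
    and distinct components leave distinct blocks. *)
Lemma mlab_graph_lpart_on H K X (XV : X \subset vset H) :
  K \subset vset H -> K != set0 -> reaches H K X ->
  mlab (graph_lpart_on K XV) = Mconn H K.
Proof.
move=> /subsetP KV /set0Pn[k0 k0K] /forall_inP KX; have /subsetP XVi := XV.
have reach k : k \in K -> exists2 x, x \in X & connect (adj H) x k.
  by move=> /KX /exists_inP[x xX kx]; exists x; rewrite // connect_adj_sym.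
have lab x k : k \in K -> connect (adj H) x k -> component H x :&: K != set0.
  by move=> kK xk; apply/set0Pn; exists k; rewrite !inE kK xk KV.
apply/cards1P/MconnP => [[A eA]|[z zV /subsetP KC]].
  have inA x k : x \in X -> k \in K -> connect (adj H) x k ->
      A = lblock (component H x :&: X) true.
    move=> xX kK xk; symmetry; apply/eqP; rewrite -in_set1 -eA inE None_lblock andbT.
    by apply/lrestrict_graphP => //; exists x => //; rewrite (lab _ _ kK xk).
  have [x0 x0X x0k] := reach _ k0K.
  exists x0; first exact: XVi.
  apply/subsetP => k kK; rewrite inE KV //=.
  have [x xX xk] := reach _ kK; apply: connect_trans (xk).
  (* The only labelled block [A] arises from [x] and from [x0] alike, so these two are connected. *)
  have : Some x \in A by rewrite (inA _ _ xX kK xk) Some_lblock !inE connect0 xX XVi.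
  by rewrite (inA _ _ x0X k0K x0k) Some_lblock !inE => /andP[/andP[]].
have [x0 x0X x0k] := reach _ k0K.
exists (lblock (component H x0 :&: X) true); apply/setP=> A; rewrite !inE.
apply/andP/eqP => [[/(lrestrict_graphP _ _ XV)[x xX ->]]|->]; last first.
  rewrite None_lblock; split=> //; apply/lrestrict_graphP => //.
  by exists x0; rewrite ?(lab _ _ k0K x0k).
rewrite None_lblock => xK; rewrite xK; have /set0Pn[k] := xK.
rewrite !inE => /andP[/andP[_ xk] kK]; congr lblock; congr (_ :&: _).
apply: eq_component; apply: connect_trans xk _.
have := KC _ kK; have := KC _ k0K; rewrite !inE => /andP[_ zk0] /andP[_ zk].
rewrite connect_adj_sym in zk; rewrite connect_adj_sym in x0k.
exact: connect_trans zk (connect_trans zk0 x0k).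
Qed.

(** This gives every contributing partition an index in the vectors. Two terminal sets occur because
    the labels come from the terminals on one side while [pi_X] uses all of them. The labelled block
    is that of a point of [X] reached by some terminal. *)
Lemma graph_lpart_on_Pi H K K' X (XV : X \subset vset H) :
  K \subset vset H -> K != set0 -> K' :&: X \subset K -> reaches H K X ->
  graph_lpart_on K XV \in Pi_l_X K' X.
Proof.
move=> /subsetP KV /set0Pn[k kK] /subsetP KK' /forall_inP KX; have /subsetP XVi := XV.
rewrite inE; apply/andP; split.
  apply/lpart_leP => _ /imsetP[x xX ->].
  exists (lblock (component H x :&: X) (component H x :&: K != set0)).
    by apply/lrestrict_graphP => //; exists x.
  apply/subsetP => -[y|].
    by rewrite !Some_lblock !inE => /eqP ->; rewrite connect0 xX XVi.
  rewrite !None_lblock => xK; apply/set0Pn; exists x.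
  by rewrite !inE connect0 XVi // KK' // inE xK.
have /exists_inP[x xX kx] := KX _ kK; apply/set0Pn.
exists (lblock (component H x :&: X) (component H x :&: K != set0)); rewrite inE None_lblock.
apply/andP; split; first by apply/lrestrict_graphP => //; exists x.
by apply/set0Pn; exists k; rewrite !inE KV // connect_adj_sym kx.
Qed.

End Reaching.

(** * Connectivity and probability across a splitting *)

Section Splitting.
Variables (T U : finType).
Implicit Types (G H : mgraph T U) (K X : {set T}).

Lemma K_splitting_sym G K G1 G2 X :
  K_splitting G K G1 G2 X -> K_splitting G K G2 G1 X.
Proof. by case=> *; split; rewrite // setUC || rewrite // setIC. Qed.

(** Deleting edges keeps the vertex sets, so each edge state is again a splitting and the later
    connectivity lemmas need not mention states. *)
Lemma K_splitting_spanning G K G1 G2 X (F1 F2 : {set U}) :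
  F1 \subset eset G1 -> F2 \subset eset G2 ->
  K_splitting G K G1 G2 X ->
  K_splitting (spanning G (F1 :|: F2)) K (spanning G1 F1) (spanning G2 F2) X.
Proof.
move=> F1E F2E [[s1 s2 s3] [t1 t2 t3] EU EI VU VI K1 K2].
have F1G := subset_trans F1E s2; have F2G := subset_trans F2E t2.
have FG : F1 :|: F2 \subset eset G by rewrite subUset F1G.
split=> //; first 1 last.
- split=> //=; first by rewrite (setIidPr FG) (setIidPr F2E) subsetUr.
  by move=> e /setIP[eE _]; apply: t3.
- by rewrite /= (setIidPr FG) (setIidPr F1E) (setIidPr F2E).
- by apply/eqP; rewrite -subset0 -EI /= setISS // subsetIl.
split=> //=; first by rewrite (setIidPr FG) (setIidPr F1E) subsetUl.
by move=> e /setIP[eE _]; apply: s3.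
Qed.

Lemma splitting_adj G K G1 G2 X x y : K_splitting G K G1 G2 X ->
  adj G x y = adj G1 x y || adj G2 x y.
Proof.
case=> [[_ s2 s3] [_ t2 t3] EU _ _ _ _ _].
apply/adjP/orP => [[e]|[] /adjP[e eE ee]].
- rewrite -EU inE => /orP[] eE ee; [left|right]; apply/adjP; exists e => //.
    by rewrite s3.
  by rewrite t3.
- by exists e; rewrite ?(subsetP s2) // -s3.
- by exists e; rewrite ?(subsetP t2) // -t3.
Qed.

Lemma splitting_separator_sub1 G K G1 G2 X : K_splitting G K G1 G2 X ->
  X \subset vset G1.
Proof. by case=> _ _ _ _ _ <- _ _; apply: subsetIl. Qed.

Lemma splitting_connect1 G K G1 G2 X x y : K_splitting G K G1 G2 X ->
  connect (adj G1) x y -> connect (adj G) x y.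
Proof.
move=> sp; apply: connect_sub => u v uv; apply: connect1.
by rewrite (splitting_adj _ _ sp) uv.
Qed.

(* A path leaving [G1] passes through the separator [X]. *)
Lemma splitting_reaches1 G K G1 G2 X : K_splitting G K G1 G2 X ->
  Mconn G K -> reaches G1 (K :&: vset G1) X.
Proof.
move=> sp /MconnP[z zV /subsetP KC]; apply/forall_inP => k /setIP[kK k1].
case: (sp) => _ _ _ _ _ VI _ /set0Pn[k' /setIP[k'K k'2]].
have kk' : connect (adj G) k k'.
  have := KC _ kK; have := KC _ k'K; rewrite !inE => /andP[_ zk'] /andP[_ zk].
  by rewrite connect_adj_sym in zk; apply: connect_trans zk zk'.
apply/exists_inP; case: (boolP [exists x in X, connect (adj G1) k x]) => [/exists_inP //|noX].
have kk1 : connect (adj G1) k k'.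
  apply: (connect_ind (P := fun v => connect (adj G1) k v)) kk' _; last exact: connect0.
  move=> u v; rewrite (splitting_adj _ _ sp) => /orP[uv ku|/adj_vset[u2 _] ku].
    exact: connect_trans ku (connect1 uv).
  case/negP: noX; apply/exists_inP; exists u => //.
  by rewrite -VI inE u2 (connect_vset ku).
by exists k' => //; rewrite -VI inE k'2 (connect_vset kk1).
Qed.

Lemma graph_lpart_on_split1 G K G1 G2 X (XV : X \subset vset G)
    (XV1 : X \subset vset G1) : K_splitting G K G1 G2 X ->
  (graph_lpart_on (K :&: vset G1) XV1 <= graph_lpart_on K XV)%O.
Proof.
move=> sp; apply/graph_lpart_onP => x xX.
(* Reflexivity, read through [graph_lpart_onP], supplies the block of [x] in the partition induced
   by [G]. *)
have /graph_lpart_onP/(_ x xX)[B [Bu xB h1 h2]] := lexx (graph_lpart_on K XV).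
exists B; split=> // [y yX xy|k /setIP[kK _] k1 xk].
  exact: h1 yX (splitting_connect1 sp xy).
apply: h2 kK _ (splitting_connect1 sp xk).
by case: sp => -[/subsetP s _ _] *; apply: s.
Qed.

Lemma graph_lpart_on_join G K G1 G2 X (XV : X \subset vset G)
    (XV1 : X \subset vset G1) (XV2 : X \subset vset G2) :
  K_splitting G K G1 G2 X ->
  (graph_lpart_on (K :&: vset G1) XV1 `|` graph_lpart_on (K :&: vset G2) XV2)%O
    = graph_lpart_on K XV.
Proof.
move=> sp; have sp' := K_splitting_sym sp.
apply/le_anti; rewrite leUx !(graph_lpart_on_split1 _ _ sp, graph_lpart_on_split1 _ _ sp') /=.
set s := (_ `|` _)%O.
have /graph_lpart_onP le1 : (graph_lpart_on (K :&: vset G1) XV1 <= s)%O by apply: leUl.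
have /graph_lpart_onP le2 : (graph_lpart_on (K :&: vset G2) XV2 <= s)%O by apply: leUr.
have [_ s2 s3] := is_lpartP _ _ (valP s).
apply/graph_lpart_onP => x xX; have [B Bs xB] := s2 _ xX.
(* Blocks of the join that share a point of [B] equal [B], so what [le1] and [le2] say about such
   blocks holds for [B]. *)
have uB y C : C \in lpval s -> Some y \in C -> Some y \in B -> C = B.
  by move=> Cs yC yB; apply: s3 Cs Bs yC yB.
have [VI] := split_separator sp.
pose touches H v := exists y, [/\ y \in X, Some y \in B & connect (adj H) y v].
(* The set of vertices joined to [B] inside [G1] or inside [G2] is closed
   under adjacency in [G]: crossing from one side to the other happens at a
   vertex of [X], which is then itself in [B]. *)
have cross1 v : v \in X -> touches G1 v -> Some v \in B.
  move=> vX [y [yX yB yv]]; have [C [Cs yC h _]] := le1 _ yX.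
  by rewrite -(uB _ _ Cs yC yB); apply: h.
have cross2 v : v \in X -> touches G2 v -> Some v \in B.
  move=> vX [y [yX yB yv]]; have [C [Cs yC h _]] := le2 _ yX.
  by rewrite -(uB _ _ Cs yC yB); apply: h.
have vset1 v : touches G1 v -> v \in vset G1.
  by case=> y [yX _ /connect_vset]; apply; apply: (subsetP XV1).
have vset2 v : touches G2 v -> v \in vset G2.
  by case=> y [yX _ /connect_vset]; apply; apply: (subsetP XV2).
have step H u v : adj H u v -> touches H u -> touches H v.
  by move=> uv [y [yX yB yu]]; exists y; split=> //; apply: connect_trans yu (connect1 uv).
have touch v : connect (adj G) x v -> touches G1 v \/ touches G2 v.
  move=> xv; apply: (connect_ind (P := fun v => touches G1 v \/ touches G2 v)) xv _.
    move=> u w; rewrite (splitting_adj _ _ sp) => /orP[] uw [] tu.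
    - by left; apply: step uw tu.
    - have uX : u \in X by rewrite -VI inE (vset2 _ tu) andbT; case: (adj_vset uw).
      by left; apply: step uw _; exists u; split=> //; apply: cross2.
    - have uX : u \in X by rewrite -VI inE (vset1 _ tu); case: (adj_vset uw).
      by right; apply: step uw _; exists u; split=> //; apply: cross1.
    - by right; apply: step uw tu.
  by left; exists x; split.
exists B; split=> // [y yX /touch[]|k kK _ /touch[] tk].
- exact: cross1.
- exact: cross2.
(* The touching path stays in one side, so [k] is a terminal of that side, and the bound from that
   side labels the block of [y], which is [B]. *)
- case: (tk) => y [yX yB yk]; have [C [Cs yC _ h]] := le1 _ yX.
  by rewrite -(uB _ _ Cs yC yB); apply: h yk; rewrite ?inE ?kK vset1.
- case: (tk) => y [yX yB yk]; have [C [Cs yC _ h]] := le2 _ yX.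
  by rewrite -(uB _ _ Cs yC yB); apply: h yk; rewrite ?inE ?kK vset2.
Qed.

Lemma splitting_Mconn G K G1 G2 X (XV1 : X \subset vset G1) (XV2 : X \subset vset G2) :
  K_splitting G K G1 G2 X -> K \subset vset G ->
  Mconn G K = [&& reaches G1 (K :&: vset G1) X, reaches G2 (K :&: vset G2) X &
    mlab (graph_lpart_on (K :&: vset G1) XV1 `|` graph_lpart_on (K :&: vset G2) XV2)%O].
Proof.
move=> sp KV; have sp' := K_splitting_sym sp.
have XV : X \subset vset G by case: sp => -[s _ _] *; apply: subset_trans XV1 s.
have K0 : K != set0.
  by have /set0Pn[k /setIP[kK _]] := split_K1 sp; apply/set0Pn; exists k.
rewrite (graph_lpart_on_join XV _ _ sp).
case: (boolP (reaches G1 _ _)) => [r1|]; last first.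
  by apply: contraNF; apply: splitting_reaches1 sp.
case: (boolP (reaches G2 _ _)) => [r2|]; last first.
  by apply: contraNF; apply: splitting_reaches1 sp'.
(* Each terminal lies on one of the two sides, and a path to [X] there is also a path in [G]. *)
rewrite mlab_graph_lpart_on //; apply/forall_inP => k kK.
have := subsetP KV _ kK; rewrite -(split_vertices sp) inE => /orP[] ki.
  have /(forall_inP r1)/exists_inP[x xX kx] : k \in K :&: vset G1 by rewrite inE kK.
  by apply/exists_inP; exists x => //; apply: splitting_connect1 sp kx.
have /(forall_inP r2)/exists_inP[x xX kx] : k \in K :&: vset G2 by rewrite inE kK.
by apply/exists_inP; exists x => //; apply: splitting_connect1 sp' kx.
Qed.

(** The edge sets are disjoint, so the failed edges of [G] also split into those of the two
    sides. *)
Lemma Pr_splitting (R : realFieldType) (p : U -> R) G K G1 G2 X (F1 F2 : {set U}) :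
  K_splitting G K G1 G2 X -> F1 \subset eset G1 -> F2 \subset eset G2 ->
  Pr p G (F1 :|: F2) = Pr p G1 F1 * Pr p G2 F2.
Proof.
move=> [_ _ EU EI _ _ _ _] F1E F2E.
have dis (A B : {set U}) : A \subset eset G1 -> B \subset eset G2 -> [disjoint A & B].
  by move=> AE BE; rewrite -setI_eq0 -subset0 -EI setISS.
have prodU (A B : {set U}) (f : U -> R) : A \subset eset G1 -> B \subset eset G2 ->
    \prod_(e in A :|: B) f e = \prod_(e in A) f e * \prod_(e in B) f e.
  move=> AE BE; rewrite -bigU ?dis //; apply: eq_bigl => e.
  by rewrite !inE.
rewrite /Pr prodU // mulrACA; congr (_ * _).
rewrite -EU setDUl -!setDDl.
have -> : eset G1 :\: F1 :\: F2 = eset G1 :\: F1.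
  by apply/setDidPl; rewrite dis // subsetDl.
have -> : eset G2 :\: F1 = eset G2.
  by apply/setDidPl; rewrite disjoint_sym dis.
by rewrite prodU ?subsetDl.
Qed.

End Splitting.

(** * Partition vectors as combinations of unit vectors *)

Section PartitionVector.
Variables (R : realFieldType) (T U : finType) (p : U -> R).
Implicit Types (H : mgraph T U) (K X : {set T}).

(** Summing vectors over states, instead of states within each entry, lets bilinearity expand the
    matrix product over pairs of states. *)
Lemma pvec_sum H K X n (o : n.-tuple (lpart X)) :
  pvec p H K o = \sum_(F : {set U} | F \subset eset H)
    ((Mconn (identify (spanning H F) X) (identify_set K X))%:R * Pr p H F) *:
      \col_i (Dind (spanning H F) K (tnth o i))%:R.
Proof.
apply/colP=> i; rewrite mxE summxE; apply: eq_bigr => F _.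
by rewrite !mxE mulrC mulrA mulrC mulrA.
Qed.

(** A state induces a single partition, which occurs only once in [o]. *)
Lemma Dind_col H K X (XV : X \subset vset H) n (o : n.-tuple (lpart X)) i :
  uniq o -> tnth o i = graph_lpart_on K XV ->
  \col_j (Dind H K (tnth o j))%:R = delta_mx i 0 :> 'cV[R]_n.
Proof.
move=> /tuple_uniqP o_inj oi; apply/colP=> j; rewrite !mxE eqxx andbT; congr _%:R.
rewrite /Dind -[lrestrict _ _]/(lpval (graph_lpart_on K XV)) -oi.
by rewrite (inj_eq val_inj) (inj_eq o_inj) eq_sym.
Qed.

End PartitionVector.

(** * The splitting formula *)

Theorem theorem5p17 (R : realFieldType) (T U : finType)
    (G G1 G2 : mgraph T U) (K X : {set T}) (p : U -> R)
    (hp : forall e, e \in eset G -> 0 <= p e <= 1)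
    (hKV : K \subset vset G) (hK : (2 <= #|K|)%N)
    (hsplit : K_splitting G K G1 G2 X)
    (n : nat) (o : n.-tuple (lpart X))
    (o_uniq : uniq o) (o_enum : o =i Pi_l_X K X) :
  (reliability p G K)%:M =
    (pvec p G1 (K :&: vset G1) o)^T *m joinmx R o *m
    pvec p G2 (K :&: vset G2) o :> 'M[R]_1.
Proof.
have XV1 := splitting_separator_sub1 hsplit.
have XV2 := splitting_separator_sub1 (K_splitting_sym hsplit).
rewrite !pvec_sum /reliability -(split_edges hsplit).
rewrite big_subsetU ?(split_edges_disjoint hsplit) //.
(* Both sides become sums over pairs [F1], [F2]; the terms are compared one by one. *)
rewrite [LHS]raddf_sum [X in X *m _ *m _]linear_sum !mulmx_suml /=; apply: eq_bigr => F1 F1E.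
rewrite raddf_sum mulmx_sumr /=; apply: eq_bigr => F2 F2E.
have sp := K_splitting_spanning F1E F2E hsplit.
rewrite (Pr_splitting p hsplit F1E F2E).
have -> := splitting_Mconn (G1 := spanning G1 F1) (G2 := spanning G2 F2) XV1 XV2 sp hKV.
rewrite !Mconn_identify ?subsetIr //.
(* A state failing to reach [X] on some side contributes zero to both sums. It must be set aside
   first, since its partition may lack a labelled block and so have no index in [o]. *)
case: (boolP (reaches (spanning G1 F1) _ _)) => [r1|_]; last first.
  by rewrite !mul0r scale0r trmx0 !mul0mx raddf0.
case: (boolP (reaches (spanning G2 F2) _ _)) => [r2|_]; last first.
  by rewrite !mul0r scale0r mulmx0 raddf0.
have KX (V : {set T}) : X \subset V -> K :&: X \subset K :&: V by apply: setIS.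
have Pi1 : graph_lpart_on (H := spanning G1 F1) (K :&: vset G1) XV1 \in o.
  rewrite o_enum; apply: graph_lpart_on_Pi r1; rewrite ?subsetIr ?(split_K1 hsplit) //.
  exact: KX.
have Pi2 : graph_lpart_on (H := spanning G2 F2) (K :&: vset G2) XV2 \in o.
  rewrite o_enum; apply: graph_lpart_on_Pi r2; rewrite ?subsetIr ?(split_K2 hsplit) //.
  exact: KX.
have [i ei] := tnthP _ _ Pi1; have [j ej] := tnthP _ _ Pi2.
rewrite (Dind_col R o_uniq (esym ei)) (Dind_col R o_uniq (esym ej)).
(* The unit vectors select the entry of [joinmx] at row [i] and column [j], which is [mlab] of the
   join of the two induced partitions. *)
rewrite !mul1r [X in X *m _ *m _]linearZ /= trmx_delta -!scalemxAl -scalemxAr -rowE -colE.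
apply/matrixP=> a b; rewrite !ord1 !mxE eqxx mulr1n -ei -ej.
by rewrite mulrC -mulrA.
Qed.
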